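(* Let $x_1=x_2=1$ and $x_n=x_{n-1}+2x_{n-2}$ for $n\ge 3$. Let $N$ be a positive integer and let $(y_n)_{n=2}^{2N}$ be the linear convolution with itself of the finite sequence $(x_n)_{n=1}^{N}$. If $N$ is even, the maximum of $y_2,\dots,y_{2N}$ is located at index $2N-1$; if $N$ is odd, the maximum is located at index $2N$.
   Context: The self linear convolution of $(x_n)_{n=1}^{N}$ is the sequence $(y_n)_{n=2}^{2N}$ given by $y_n=\sum_{k=1}^{n-1}x_kx_{n-k}$ for $2\le n\le N$ and $y_{N+j}=\sum_{k=j}^{N}x_kx_{N+j-k}$ for $1\le j\le N$, that is, $y_n=\sum x_kx_{n-k}$ over all $k$ with $1\le k\le N$ and $1\le n-k\le N$. The recurrence $x_n=x_{n-1}+2x_{n-2}$ has characteristic equation $x^2-x-2=0$, whose largest positive real root is $2$. *)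

(* Defs.v *)
From mathcomp Require Import all_boot.

Set Implicit Arguments.
Unset Strict Implicit.
Unset Printing Implicit Defensive.

(* Self linear convolution of the finite sequence x_1, ..., x_N, at index n.
   Entries of x outside 1..N are never used. The subtraction n - k is
   truncated, but it equals 0 when n <= k, so the filter discards such k. *)
Definition self_convolution (x : nat -> nat) (N n : nat) : nat :=
  \sum_(1 <= k < N.+1 | 1 <= n - k <= N) x k * x (n - k).

(* The maximum of f_a, ..., f_b is attained at the index m and only there. *)
Definition max_located_at (f : nat -> nat) (a b m : nat) : Prop :=
  a <= m <= b /\ forall i : nat, a <= i <= b -> i <> m -> f i < f m.

(* Main.v *)
Require Import Defs.
From mathcomp Require Import all_boot.
From mathcomp Require Import zify.

(** For [N <> 3] the convolution [y] increases strictly up to the index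
    [2N - 1].  Up to index [N + 1] this is because each step adds a term and
    [x] is nondecreasing.  For [n = a + N] with [1 <= a <= N - 2],
    expanding [x_(j+1) = x_j + 2 x_(j-1)] in [y_(n+1)] and cancelling [y_n]
    leaves positive terms against a multiple of [x_a x_N]; the terms with
    smallest [j] win because [x_N <= 2 x_(N-1) + 1].  The maximum is thus
    decided between [y_(2N-1) = 2 x_(N-1) x_N] and [y_(2N) = x_N ^ 2], where
    [x_N = 2 x_(N-1) + 1] for odd [N] and [x_N = 2 x_(N-1) - 1] for even [N]. *)

Lemma self_convolution_low (x : nat -> nat) (N n : nat) : n <= N.+1 ->
  self_convolution x N n = \sum_(1 <= k < n) x k * x (n - k).
Proof.
move=> nN; case: (posnP n) => [->|n0].
  by rewrite /self_convolution [RHS]big_geq // big_nat_cond big1 // => k; lia.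
rewrite /self_convolution (big_cat_nat (n := n)) //=.
rewrite [X in _ + X]big_nat_cond [X in _ + X]big1 ?addn0; last by move=> k; lia.
rewrite [LHS]big_nat_cond [RHS]big_nat_cond; apply: eq_bigl => k; lia.
Qed.

Lemma self_convolution_high (x : nat -> nat) (N a : nat) : 0 < a <= N ->
  self_convolution x N (a + N) = \sum_(a <= k < N.+1) x k * x (a + N - k).
Proof.
move=> aN; rewrite /self_convolution (big_cat_nat (n := a)) //=; [|lia..].
rewrite [X in X + _]big_nat_cond [X in X + _]big1 ?add0n; last by move=> k; lia.
rewrite [LHS]big_nat_cond [RHS]big_nat_cond; apply: eq_bigl => k; lia.
Qed.

Section Jacobsthal.

Variable x : nat -> nat.
Hypotheses (hx1 : x 1 = 1) (hx2 : x 2 = 1).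
Hypothesis hrec : forall n, 3 <= n -> x n = x (n - 1) + 2 * x (n - 2).

Lemma jacobsthalSS n : 0 < n -> x n.+2 = x n.+1 + 2 * x n.
Proof. by move=> n0; rewrite hrec // subn1 subn2. Qed.

(** This encodes x_(n+1) - 2 x_n = (-1)^n without subtraction. The recurrence gives x_(n+2) - 2
    x_(n+1) = -(x_(n+1) - 2 x_n), so the sign alternates. *)
Lemma jacobsthalS n : 0 < n -> x n.+1 + odd n = 2 * x n + ~~ odd n.
Proof.
case: n => // n _; elim: n => [|n IHn]; first by rewrite hx1 hx2.
by rewrite jacobsthalSS //; move: IHn => /=; case: (odd n) => /=; lia.
Qed.

Lemma jacobsthal_gt0 n : 0 < n -> 0 < x n.
Proof.
case: n => // n _; elim: n => [|n IHn]; first by rewrite hx1.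
by have := jacobsthalS n.+1 isT; case: odd => /=; lia.
Qed.

Lemma jacobsthal_leS n : 0 < n -> x n <= x n.+1.
Proof.
by move=> n0; have := jacobsthalS n n0; have := jacobsthal_gt0 n n0; case: odd => /=; lia.
Qed.

Lemma jacobsthal_le m n : 0 < m -> m <= n -> x m <= x n.
Proof.
move=> m0 /subnK <-; elim: (n - m) => // d IHd.
by apply: leq_trans IHd _; apply: jacobsthal_leS; lia.
Qed.

Lemma self_convolution_ltS_low N n : 0 < n <= N ->
  self_convolution x N n < self_convolution x N n.+1.
Proof.
move=> /andP[n0 nN]; rewrite !self_convolution_low; [|lia..].
(* The term k = 1 is the extra one and supplies strictness; the others, shifted by one, dominate
   termwise. *)
rewrite (big_nat_recl _ 1 (fun k => x k * x (n.+1 - k))) // hx1 mul1n subn1 /=.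
rewrite -add1n; apply: leq_add; first exact: jacobsthal_gt0.
rewrite [leqLHS]big_nat [leqRHS]big_nat; apply: leq_sum => k kn.
by rewrite subSS leq_mul // jacobsthal_leS //; lia.
Qed.

Lemma self_convolution_ltS_high N a : 3 < N -> 0 < a -> a + 2 <= N ->
  self_convolution x N (a + N) < self_convolution x N (a + N).+1.
Proof.
move=> N3 a0 aN; rewrite -addSn !self_convolution_high; [|lia..].
rewrite big_add1 /= (big_nat_recr N) /=; last lia.
(* The term j = a stays unexpanded: for a = 1 the recurrence would involve [x 0], which is
   arbitrary. *)
rewrite !(@big_ltn _ _ _ a N) /=; [|lia..].
have -> : \sum_(a.+1 <= j < N) x j.+1 * x (a.+1 + N - j.+1) =
    \sum_(a.+1 <= j < N) x j * x (a + N - j) +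
    2 * \sum_(a.+1 <= j < N) x j.-1 * x (a + N - j).
  rewrite big_distrr -big_split /= big_nat [RHS]big_nat; apply: eq_bigr => j aj.
  have -> : a.+1 + N - j.+1 = a + N - j by lia.
  have := jacobsthalSS j.-1; rewrite prednK; last lia.
  by move=> ->; [rewrite mulnDl mulnA | lia].
rewrite [\sum_(a.+1 <= j < N) x j.-1 * _]big_ltn; last lia.
have -> : a.+1 + N - a.+1 = N by lia.
have -> : a + N - a = N by lia.
have -> : a + N - N = a by lia.
have -> : a + N - a.+1 = N.-1 by lia.
have xN : x N <= 2 * x N.-1 + 1.
  by have := jacobsthalS N.-1; rewrite prednK; [case: odd => /=; lia | lia].
move: (\sum_(a.+1 <= j < N) x j * _) => S /=.
(* After cancelling S, the claim is 2 x_a x_N < x_(a+1) x_N + 2 x_a x_(N-1) + 2 T, with T the sum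
   over j from a + 2 on. By [xN] it suffices that x_a x_N + x_a < x_(a+1) x_N + 2 T. For a = 1 the
   products with x_N agree, so T must be positive: its term j = 3 exists because 3 < N. For 1 < a
   the gap x_(a+1) - x_a >= 2 is enough. *)
have [a1|a2] : a = 1 \/ 1 < a by lia.
  rewrite a1 hx1 hx2 big_ltn; last lia.
  have -> : 1 + N - 3 = N - 2 by lia.
  have := jacobsthal_gt0 (N - 2); rewrite /= hx2; lia.
have xaN : x a <= x N by apply: jacobsthal_le; lia.
have xN0 : 0 < x N by apply: jacobsthal_gt0; lia.
have xa : x a + 2 <= x a.+1.
  have := jacobsthalSS a.-1; have := jacobsthal_gt0 a.-1.
  by rewrite prednK; lia.
have xaxN := leq_mul xa (leqnn (x N)).
have xaxN1 := leq_mul (leqnn (x a)) xN.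
move: (\sum_(_ <= _ < _) _) => T; nia.
Qed.

Lemma self_convolution_lt N m n : N <> 3 -> 0 < m < n -> n < 2 * N ->
  self_convolution x N m < self_convolution x N n.
Proof.
move=> N3; elim: n => [|n IHn] mn nN; first lia.
have step : self_convolution x N n < self_convolution x N n.+1.
  have [nleN|Nltn] := leqP n N; first by apply: self_convolution_ltS_low; lia.
  have -> : n = (n - N) + N by lia.
  by apply: self_convolution_ltS_high; lia.
have [->//|mltn] : m = n \/ m < n by lia.
by apply: ltn_trans step; apply: IHn; lia.
Qed.

Lemma self_convolution_last N : 0 < N ->
  self_convolution x N (2 * N) = x N * x N.
Proof.
move=> N0; rewrite mul2n -addnn self_convolution_high; last lia.
by rewrite big_nat1 addnK.
Qed.

Lemma self_convolution_penultimate N : 1 < N ->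
  self_convolution x N (2 * N - 1) = 2 * x N.-1 * x N.
Proof.
move=> N1; have -> : 2 * N - 1 = N.-1 + N by lia.
rewrite self_convolution_high; last lia.
rewrite big_nat_recr /=; last lia.
have {2}-> : N = N.-1.+1 by lia.
rewrite big_nat1 addnK; have -> : N.-1 + N - N.-1 = N by lia.
lia.
Qed.

(** For N = 3 the values y_2, ..., y_6 are 1, 2, 7, 6, 9; the drop from 7 to 6 breaks monotonicity,
    so they are computed directly. *)
Lemma self_convolution3_max i : 1 < i < 6 ->
  self_convolution x 3 i < self_convolution x 3 6.
Proof.
have hx3 : x 3 = 3 by rewrite hrec // hx1 hx2.
case: i => [|[|[|[|[|[|i]]]]]] // _;
  by rewrite /self_convolution unlock /= ?(hx1, hx2, hx3).
Qed.

End Jacobsthal.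

Theorem mainTheorem9 (x : nat -> nat)
    (hx1 : x 1 = 1) (hx2 : x 2 = 1)
    (hrec : forall n : nat, 3 <= n -> x n = x (n - 1) + 2 * x (n - 2))
    (N : nat) (hN : 0 < N) :
  (~~ odd N ->
     max_located_at (self_convolution x N) 2 (2 * N) (2 * N - 1)) /\
  (odd N ->
     max_located_at (self_convolution x N) 2 (2 * N) (2 * N)).
Proof.
have xS : 1 < N -> x N + ~~ odd N = 2 * x N.-1 + odd N.
  case: N hN => [|[|n]] // _ _.
  by have := jacobsthalS x hx1 hx2 hrec n.+1 isT; rewrite /= negbK.
have xN0 : 0 < x N by apply: jacobsthal_gt0.
split=> oddN; split; try lia; move=> i iN iNm.
- have N1 : 1 < N by lia.
  have [->|i2N] : i = 2 * N \/ i < 2 * N - 1 by lia.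
    rewrite self_convolution_last // self_convolution_penultimate //.
    by rewrite ltn_mul2r xN0; move: (xS N1); rewrite oddN; lia.
  by apply: self_convolution_lt => //; lia.
- have [N3|N3] := eqVneq N 3.
    by rewrite N3; apply: self_convolution3_max => //; lia.
  (* For N = 1 the only index is 2 = 2N, which [iNm] excludes. *)
  have N1 : 1 < N by lia.
  have top : self_convolution x N (2 * N - 1) < self_convolution x N (2 * N).
    rewrite self_convolution_last // self_convolution_penultimate //.
    by rewrite ltn_mul2r xN0; move: (xS N1); rewrite oddN; lia.
  have [->//|i2N] : i = 2 * N - 1 \/ i < 2 * N - 1 by lia.
  by apply: ltn_trans top; apply: self_convolution_lt => //; lia.
Qed.
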